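(* Let $4 \le p \le n-1$ and let $(i,j)\in A$. The nonnegativity constraint $x_{ij}\ge 0$ is valid for $P^p_{0,n}(D)$ and defines a facet of $P^p_{0,n}(D)$.
   Context: Let $n$ be a positive integer, $V=\{0,1,\dots,n\}$, and let $D=(V,A)$ be the digraph whose arc set $A$ consists of all ordered pairs $(i,j)$ with $i\neq j$, $i,j\in V$, except that no arc enters node $0$, no arc leaves node $n$, and the arc $(0,n)$ is absent. Nodes $1,\dots,n-1$ are called internal nodes. A $(0,n)$-$p$-path is a simple directed path in $D$ from $0$ to $n$ with exactly $p$ arcs (all nodes distinct). $P^p_{0,n}(D)\subseteq\mathbb{R}^A$ denotes the convex hull of the incidence vectors of all $(0,n)$-$p$-paths in $D$. An inequality is facet defining if it is valid for the polytope and the face it defines has dimension one less than the polytope. *)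

(* Defs.v *)
From mathcomp Require Import all_boot all_order all_algebra.
Set Implicit Arguments. Unset Strict Implicit. Unset Printing Implicit Defensive.
Import Order.TTheory GRing.Theory Num.Theory.
Local Open Scope ring_scope.

(* Nodes V = {0,...,n} are 'I_n.+1; node 0 is ord0, node n is ord_max. *)
Definition is_arc (n : nat) (i j : 'I_n.+1) : bool :=
  [&& i != j, j != ord0, i != ord_max & ~~ ((i == ord0) && (j == ord_max))].

Definition arcD (n : nat) := {a : 'I_n.+1 * 'I_n.+1 | is_arc a.1 a.2}.

(* A (0,n)-p-path, given by its node sequence s = [0; v1; ...; vp = n]:
   p arcs, all nodes distinct, consecutive nodes joined by arcs of D. *)
Definition is_p_path (n p : nat) (s : seq 'I_n.+1) : Prop :=
  [/\ size s = p.+1, head ord0 s = ord0, last ord0 s = ord_max,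
      uniq s & path (@is_arc n) ord0 (behead s)].

Definition incidence (R : pzRingType) (n : nat) (s : seq 'I_n.+1) (a : arcD n) : R :=
  if val a \in zip s (behead s) then 1 else 0.

Definition path_polytope (R : realFieldType) (n p : nat) (x : arcD n -> R) : Prop :=
  exists (k : nat) (lam : 'I_k -> R) (P : 'I_k -> seq 'I_n.+1),
    [/\ forall t, 0 <= lam t, \sum_(t < k) lam t = 1,
        forall t, is_p_path p (P t)
      & forall a, x a = \sum_(t < k) lam t * incidence R (P t) a].

Definition aff_indep_pts (R : realFieldType) (T : Type) (X : (T -> R) -> Prop) (k : nat)
  : Prop :=
  exists v : 'I_k.+1 -> (T -> R),
    (forall t, X (v t)) /\
    (forall mu : 'I_k.+1 -> R,
        (forall a, \sum_(t < k.+1) mu t * v t a = 0) ->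
        \sum_(t < k.+1) mu t = 0 -> forall t, mu t = 0).

Definition has_dim (R : realFieldType) (T : Type) (X : (T -> R) -> Prop) (d : nat) : Prop :=
  aff_indep_pts X d /\ ~ aff_indep_pts X d.+1.

Definition nonneg_valid (R : realFieldType) (T : Type) (X : (T -> R) -> Prop) (a : T) : Prop :=
  forall x, X x -> 0 <= x a.

Definition nonneg_face (R : realFieldType) (T : Type) (X : (T -> R) -> Prop) (a : T)
  (x : T -> R) : Prop := X x /\ x a = 0.

Definition nonneg_facet (R : realFieldType) (T : Type) (X : (T -> R) -> Prop) (a : T) : Prop :=
  nonneg_valid X a /\
  exists d : nat, has_dim X d.+1 /\ has_dim (nonneg_face X a) d.

(* Main.v *)
Require Import Defs.
From mathcomp Require Import all_boot all_order all_algebra.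
From mathcomp Require Import lra zify.
(** All incidence vectors lie on the hyperplane [\sum_a x a = p], which misses
    the origin, so dimensions are ranks minus one, and it suffices to show that
    the paths through the arc [a] raise the rank of the paths avoiding [a] by
    exactly one.  Dually: a weighting of the arcs that vanishes on every p-path
    avoiding [a] takes a single value on the p-paths through [a].  After
    subtracting potentials so that arcs out of node 0 weigh 0, exchanging the
    first, then the second internal node of a path with an unused one shows
    that the remaining arc weights are constant, up to exceptions forced
    by [a]. *)
Set Implicit Arguments. Unset Strict Implicit. Unset Printing Implicit Defensive.
Import Order.TTheory GRing.Theory Num.Theory.
Local Open Scope ring_scope.

(** * Weights of paths and the arcs they traverse *)

Fixpoint path_weight (R : nmodType) (V : Type) (w : V -> V -> R) (x : V) (s : seq V) : R :=
  if s is y :: s' then w x y + path_weight w y s' else 0.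

(** Stated as a relation, so that [path (avoids a)] says that a node sequence does not traverse
    [a]. *)
Definition avoids (V : eqType) (a : V * V) : rel V := fun u v => (u, v) != a.

Section PathWeight.
Variables (V : eqType).
Implicit Types (x : V) (s : seq V).

Lemma path_weight_rcons (R : nmodType) (w : V -> V -> R) x s z :
  path_weight w x (rcons s z) = path_weight w x s + w (last x s) z.
Proof.
elim: s x => [|y s IHs] x /=; first by rewrite addr0 add0r.
by rewrite IHs addrA.
Qed.

Lemma path_weight_map (R : nmodType) (U : Type) (h : U -> V) (w : V -> V -> R) u (s : seq U) :
  path_weight w (h u) (map h s) = path_weight (fun u v => w (h u) (h v)) u s.
Proof. by elim: s u => //= v s IHs u; rewrite IHs. Qed.

(** Potential differences telescope, so only the two end nodes contribute. *)
Lemma path_weight_potential (R : zmodType) (w : V -> V -> R) (f : V -> R) x s :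
  path_weight (fun u v => w u v + f u - f v) x s
  = path_weight w x s + f x - f (last x s).
Proof.
elim: s x => [|y s IHs] x /=; first by rewrite add0r subrr.
rewrite IHs !addrA; congr (_ - _).
rewrite (addrAC _ (- f y)) subrK -!addrA; congr (_ + _); exact: addrC.
Qed.

Lemma sum_zip_path_weight (R : nmodType) (w : V -> V -> R) x s :
  \sum_(e <- zip (x :: s) s) w e.1 e.2 = path_weight w x s.
Proof.
elim: s x => [|y s IHs] x; first by rewrite big_nil.
by rewrite [zip _ _]/= big_cons IHs.
Qed.

Lemma mem_zip_behead a x s : (a \in zip (x :: s) s) = ~~ path (avoids a) x s.
Proof.
elim: s x => [|y s IHs] x //.
by rewrite [zip _ _]/= inE IHs /= negb_and negbK eq_sym.
Qed.

(** The first components of the pairs form a subsequence of [x :: s]. *)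
Lemma uniq_zip_behead x s : uniq (x :: s) -> uniq (zip (x :: s) s).
Proof.
move=> Us; apply: (@map_uniq _ _ fst); apply: subseq_uniq Us.
by elim: s x => //= y s IHs x; rewrite eqxx.
Qed.

Lemma avoids_notin_behead i j x s : j \notin s -> path (avoids (i, j)) x s.
Proof.
elim: s x => //= y s IHs x; rewrite inE negb_or => /andP[nj /IHs ->].
by rewrite /avoids xpair_eqE negb_and (eq_sym y) nj orbT.
Qed.

Lemma avoids_notin i j x s : i \notin x :: s -> path (avoids (i, j)) x s.
Proof.
elim: s x => //= y s IHs x; rewrite inE negb_or => /andP[ni /IHs ->].
by rewrite /avoids xpair_eqE negb_and (eq_sym x) ni.
Qed.

Lemma path_weight_const (R : nmodType) (w : V -> V -> R) (e : rel V) c x s :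
  (forall u v, u != v -> e u v -> w u v = c) ->
  uniq (x :: s) -> path e x s -> path_weight w x s = c *+ size s.
Proof.
move=> wc; elim: s x => //= y s IHs x.
rewrite inE negb_or => /andP[/andP[nxy _] Us] /andP[na Ps].
by rewrite IHs // wc // mulrS.
Qed.

(** Nodes do not repeat, so the path leaves [i] only once and its other steps all weigh [c]. *)
Lemma path_weight_through (R : nmodType) (w : V -> V -> R) i j c x s :
  (forall u v, u != v -> (u, v) != (i, j) -> w u v = c) ->
  uniq (x :: s) -> ~~ path (avoids (i, j)) x s ->
  path_weight w x s = w i j + c *+ (size s).-1.
Proof.
move=> wc; elim: s x => //= y s IHs x.
rewrite inE negb_or negb_and negbK => /andP[/andP[nxy nxs] Us] Ps.
have [[ex ey]|na] := eqVneq (x, y) (i, j).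
  rewrite ex ey in nxy nxs Us *.
  rewrite (path_weight_const wc) //.
  by apply: avoids_notin; rewrite inE negb_or nxy.
rewrite (negPf na) /= in Ps; rewrite wc // IHs //.
by case: (s) Ps => //= z s' _; rewrite mulrS addrCA.
Qed.

End PathWeight.

(** * Exchange arguments on internal nodes, one for each kind of arc *)

Lemma fresh_seq (T : finType) (F : seq T) r :
  uniq F -> (size F + r <= #|T|)%N -> exists2 l, size l = r & uniq (F ++ l).
Proof.
move=> UF le; exists (take r [seq x <- enum T | x \notin F]).
  apply: size_takel; rewrite size_filter.
  have := count_predC (mem F) (enum T); rewrite -cardE.
  have -> : count (mem F) (enum T) = size F.
    rewrite -size_filter; apply: perm_size; apply: uniq_perm => //.
      by rewrite filter_uniq ?enum_uniq.
    by move=> x; rewrite mem_filter mem_enum andbT.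
  rewrite (eq_count (a2 := [pred x | x \notin F])) //.
  by move: le => /=; lia.
rewrite cat_uniq UF /=; apply/andP; split; last by apply: take_uniq; rewrite filter_uniq // enum_uniq.
by apply/hasPn => x /mem_take; rewrite mem_filter => /andP[].
Qed.

(* A (0,n)-p-path is encoded by the sequence [x :: l] of its internal nodes,
   with [p = r + 4]; [thru] tells which sequences use the arc at stake.  Arcs
   out of node 0 carry no weight (potentials normalize them to 0), the arc from
   [v] into node n has weight [g v]. *)
Definition pivot (R : realFieldType) (T : finType) (r : nat)
    (thru : T -> seq T -> bool) : Prop :=
  let adm x l := uniq (x :: l) /\ size l = r.+2 in
  [/\ exists x l, adm x l /\ ~~ thru x l, exists x l, adm x l /\ thru x l
    & forall (w : T -> T -> R) (g : T -> R),
        (forall x l, adm x l -> ~~ thru x l -> path_weight w x l + g (last x l) = 0) ->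
        forall x l y m, adm x l -> thru x l -> adm y m -> thru y m ->
          path_weight w x l + g (last x l) = path_weight w y m + g (last y m)].


Ltac unpack_uniq H :=
  move: (H); rewrite /= ?inE ?mem_cat ?negb_or /= => H';
  repeat match goal with K : is_true (_ && _) |- _ => case/andP: K => ? ? end.

Ltac solve_uniq :=
  rewrite /= ?inE ?negb_or /=; repeat (apply/andP; split);
  first [done | by rewrite eq_sym].

Section Pivot.
Variables (R : realFieldType) (T : finType) (r : nat).
Hypothesis cardT : (r.+4 <= #|T|)%N.

(** A path has [r + 3] internal nodes, so [r + 4] available nodes leave the one spare node that an
    exchange needs. *)
Lemma fresh_nodes (F : seq T) t : uniq F -> (size F + t <= r.+4)%N ->
  exists2 l, size l = t & uniq (F ++ l).
Proof. by move=> UF le; apply: fresh_seq => //; apply: leq_trans cardT. Qed.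

Section Exchange.
Variables (thru : T -> seq T -> bool) (w : T -> T -> R) (g : T -> R).
Hypothesis H : forall x l, uniq (x :: l) /\ size l = r.+2 -> ~~ thru x l ->
  path_weight w x l + g (last x l) = 0.

(** The two paths differ only in their first internal node. Arcs out of node 0 weigh nothing, so
    only the arcs into [y] can differ. *)
Lemma exchange_first x x' y l : uniq [:: x, x', y & l] -> size l = r.+1 ->
  ~~ thru x (y :: l) -> ~~ thru x' (y :: l) -> w x y = w x' y.
Proof.
move=> U sl t t'; unpack_uniq U.
have /= E : path_weight w x (y :: l) + g (last x (y :: l)) = 0.
  by apply: H => //; split; [solve_uniq | rewrite /= sl].
have /= E' : path_weight w x' (y :: l) + g (last x' (y :: l)) = 0.
  by apply: H => //; split; [solve_uniq | rewrite /= sl].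
lra.
Qed.

Lemma exchange_second u y y' z l : uniq [:: u, y, y', z & l] -> size l = r ->
  ~~ thru u [:: y, z & l] -> ~~ thru u [:: y', z & l] ->
  w u y + w y z = w u y' + w y' z.
Proof.
move=> U sl t t'; unpack_uniq U.
have /= E : path_weight w u [:: y, z & l] + g (last u [:: y, z & l]) = 0.
  by apply: H => //; split; [solve_uniq | rewrite /= sl].
have /= E' : path_weight w u [:: y', z & l] + g (last u [:: y', z & l]) = 0.
  by apply: H => //; split; [solve_uniq | rewrite /= sl].
lra.
Qed.

End Exchange.

(** Arc [(i, n)]. When [i] is one of the three leading nodes of an exchange it cannot be the last
    node, so both paths avoid the arc. Such exchanges make all weights between internal nodes equal,
    and every path ending in [i] has this common total plus [g i]. *)
Lemma pivot_last (i : T) : pivot R r (fun x l => last x l == i).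
Proof.
split.
- have [[|x l] // [sl] /= /andP[Ni Ul]] := @fresh_nodes [:: i] r.+3 isT (leqnn _).
  exists x, l; do ?split => //; apply: contraNneq Ni => <-; exact: mem_last.
- have [[|x l] // [sl] Ul] := @fresh_nodes [:: i] r.+2 isT (leqnSn _).
  exists x, (rcons l i); rewrite last_rcons size_rcons sl -rcons_cons rcons_uniq.
  by split.
move=> w g H.
have last_fresh F z l : uniq (F ++ z :: l) -> i \in F -> last z l != i.
  move=> U iF; apply: contraTneq U => e; rewrite cat_uniq; apply/nandP; right.
  apply/nandP; left; rewrite negbK; apply/hasP; exists i => //; rewrite -e.
  exact: mem_last.
have first x x' y : uniq [:: x; x'; y] -> i \in [:: x; x'; y] -> w x y = w x' y.
  move=> U iF; have [[|z l] // [sl] Ul] := @fresh_nodes _ r.+1 U (leqnn _).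
  have ne := last_fresh _ _ _ Ul iF.
  by apply: (exchange_first H Ul) => //=; rewrite sl.
have indep x x' y : x != y -> x' != y -> w x y = w x' y.
  (* Compare every tail with [i], because [first] needs [i] among its three nodes. *)
  have hub u : u != y -> u != i -> y != i -> w u y = w i y.
    by move=> *; apply: first; [solve_uniq | rewrite !inE eqxx !orbT].
  have [-> //|xx'] := eqVneq x x' => xy x'y.
  have [yi|yi] := eqVneq y i.
    by apply: first; [solve_uniq | rewrite yi !inE eqxx !orbT].
  have [->|xi] := eqVneq x i; have [->|x'i] := eqVneq x' i => //.
  - by rewrite [RHS]hub.
  - by rewrite hub.
  by rewrite !hub.
have second u y y' : uniq [:: u; y; y'] -> i \in [:: u; y; y'] -> w u y = w u y'.
  move=> U iF; have [[|z l] // [sl] Ul] := @fresh_nodes _ r.+1 U (leqnn _).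
  have ne := last_fresh _ _ _ Ul iF; unpack_uniq Ul.
  have := exchange_second H Ul sl ne ne.
  by rewrite (indep y y' z) // => /addIr.
have [[|o []] // _] := @fresh_nodes [:: i] 1 isT isT.
rewrite /= inE andbT => io.
have const x y : x != y -> w x y = w i o.
  move=> xy; have [ey|yi] := eqVneq y i.
    rewrite {}ey in xy *.
    (* An auxiliary node [z] gives the chain [w x i = w z i = w z o = w i o]. *)
    have Uio : uniq [:: i; o] by solve_uniq.
    have [[|z []] // _ Uz] := @fresh_nodes _ 1 Uio isT.
    unpack_uniq Uz.
    have -> : w x i = w z i by apply: indep => //; rewrite eq_sym.
    have -> : w z i = w z o.
      by apply: second; [solve_uniq | rewrite !inE eqxx orbT].
    by apply: indep => //; rewrite eq_sym.
  rewrite (indep x i) // 1?eq_sym //; have [-> //|yo] := eqVneq y o.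
  by apply: second; [solve_uniq | rewrite !inE eqxx].
have wt x l : uniq (x :: l) -> size l = r.+2 -> path_weight w x l = w i o *+ r.+2.
  move=> U <-; apply: (@path_weight_const _ _ _ (fun _ _ => true)) => //.
    by move=> u v nuv _; apply: const.
  by elim: l x {U} => //= y l IHl x.
by move=> x l y m [Ux sl] /eqP -> [Uy sm] /eqP ->; rewrite !wt.
Qed.

(** Arc [(0, j)]. Weights between nodes other than [j] equal a constant [c], and arcs into [j] share
    one weight. Paths visiting [j] in second place avoid the arc and determine the weights out of
    [j], hence the value of any path starting in [j]. *)
Lemma pivot_head (j : T) : pivot R r (fun x _ => x == j).
Proof.
split.
- have [[|x l] // [sl] /= /andP[Nj Ul]] := @fresh_nodes [:: j] r.+3 isT (leqnn _).
  by exists x, l; do ?split => //; move: Nj; rewrite inE negb_or eq_sym => /andP[].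
- have [l sl Ul] := @fresh_nodes [:: j] r.+2 isT (leqnSn _).
  by exists j, l.
move=> w g H.
have indep x x' y : uniq [:: x; x'; y] -> x != j -> x' != j -> w x y = w x' y.
  move=> U nx nx'; have [l sl Ul] := @fresh_nodes _ r.+1 U (leqnn _).
  exact: (exchange_first H Ul).
have indep' x x' y : x != y -> x' != y -> x != j -> x' != j -> w x y = w x' y.
  by have [-> //|xx' *] := eqVneq x x'; apply: indep => //; solve_uniq.
have second y y' : y != j -> y' != j -> y != y' ->
    exists u, [/\ u != j, u != y, u != y' & w u y = w u y'].
  move=> nj nj' yy'; have U : uniq [:: j; y; y'] by solve_uniq.
  have [[|u []] // _ Uu] := @fresh_nodes _ 1 U isT; unpack_uniq Uu.
  have U' : uniq [:: u; y; y'] by solve_uniq.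
  have [[|z l] // [sl] Ul] := @fresh_nodes _ r.+1 U' (leqnn _).
  exists u; do ?split; rewrite 1?eq_sym //.
  have ju : u != j by rewrite eq_sym.
  have := exchange_second H Ul sl ju ju; unpack_uniq Ul.
  by rewrite (indep' y y' z) // => /addIr.
have [[|o [|o' []]] // _ Uo] := @fresh_nodes [:: j] 2 isT isT.
unpack_uniq Uo.
have const x y : x != y -> (x != j) && (y != j) -> w x y = w o' o.
  move=> xy /andP[xj yj]; have [ey|yo] := eqVneq y o.
    by rewrite {}ey in xy *; apply: indep' => //; rewrite eq_sym.
  have oj : o != j by rewrite eq_sym.
  have [u [uj uy uo e]] := second y o yj oj yo.
  by rewrite (indep' x u) // e; apply: indep' => //; rewrite eq_sym.
pose c := w o' o.
have wt x l : uniq (x :: l) -> j \notin x :: l -> path_weight w x l = c *+ size l.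
  move=> U nj; apply: path_weight_const const U _.
  elim: l x nj => //= y l IHl x; rewrite !inE !negb_or => /and3P[nx ny nl].
  by rewrite eq_sym nx eq_sym ny IHl // inE negb_or ny.
(* Evaluate a path that ends in [z] and misses [j] altogether. *)
have gE z : z != j -> g z = - (c *+ r.+2).
  move=> zj; have U : uniq [:: j; z] by solve_uniq.
  have [[|x l] // [sl] Ul] := @fresh_nodes _ r.+2 U (leqnn _).
  unpack_uniq Ul.
  have := H x (rcons l z).
  rewrite last_rcons wt; first last.
  - by rewrite -rcons_cons mem_rcons !inE !negb_or; solve_uniq.
  - by rewrite -rcons_cons rcons_uniq inE negb_or; solve_uniq.
  rewrite size_rcons sl => E; apply/eqP; rewrite -addr_eq0 addrC; apply/eqP; apply: E.
    by split => //; rewrite -rcons_cons rcons_uniq inE negb_or; solve_uniq.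
  by rewrite eq_sym.
(* A path [u, j, z, ...] gives [w u j + w j z + c *+ r - c *+ r.+2 = 0], where [w u j = w o j]. *)
have out z : z != j -> w j z = c *+ 2 - w o j.
  move=> zj; have U : uniq [:: j; z] by solve_uniq.
  have [[|u l] // [sl] Ul] := @fresh_nodes _ r.+1 U (leqnSn _).
  unpack_uniq Ul.
  have uj : u != j by rewrite eq_sym.
  have nlast : last z l != j.
    have: j \notin z :: l by solve_uniq.
    by apply: contraNneq => <-; apply: mem_last.
  have /= : path_weight w u [:: j, z & l] + g (last u [:: j, z & l]) = 0.
    by apply: H => //; split; [solve_uniq | rewrite /= sl].
  rewrite wt; [|by solve_uniq..].
  have oj : o != j by rewrite eq_sym.
  rewrite (gE _ nlast) (indep' u o j) // sl !mulrSr.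
  by set cr := c *+ r => E; lra.
have thruE l : uniq (j :: l) -> size l = r.+2 ->
    path_weight w j l + g (last j l) = c *+ 2 - w o j - c.
  case: l => [|z l] //= /andP[nj Uz] [sl].
  have zj : z != j by apply: contraNneq nj => ->; rewrite mem_head.
  have nlast : last z l != j by apply: contraNneq nj => <-; apply: mem_last.
  rewrite (out _ zj) wt // (gE _ nlast) sl !mulrSr.
  by set cr := c *+ r; lra.
by move=> x l y m [Ux sl] /eqP ex [Uy sm] /eqP ey; subst x y; rewrite !thruE.
Qed.

(** Arc [(i, j)] between internal nodes. Every other weight turns out to be [c] and every [g z] to
    be [- (c *+ r.+2)], so each path through the arc has value [w i j - c]. *)
Lemma pivot_arc (i j : T) : i != j -> pivot R r (fun x l => ~~ path (avoids (i, j)) x l).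
Proof.
move=> nij; have Uij : uniq [:: i; j] by solve_uniq.
split.
- have [[|x l] // [sl] /= /andP[Nj Ul]] := @fresh_nodes [:: j] r.+3 isT (leqnn _).
  exists x, l; split => //; rewrite negbK; apply: avoids_notin_behead.
  by move: Nj; rewrite inE negb_or => /andP[].
- have [l sl Ul] := @fresh_nodes _ r.+1 Uij (leqnSn _).
  by exists i, (j :: l); rewrite /avoids /= eqxx /= sl.
move=> w g H.
(* A path that starts in [j] never enters it from an internal node, so [j] can serve as reference
   tail. *)
have first x y : uniq [:: x; j; y] -> w x y = w j y.
  move=> U; have [l sl Ul] := @fresh_nodes _ r.+1 U (leqnn _); unpack_uniq Ul.
  by apply: (exchange_first H Ul) => //; rewrite negbK;
     apply: avoids_notin_behead; solve_uniq.
have second y y' : uniq [:: j; y; y'] -> w j y = w j y'.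
  move=> U; have [[|z l] // [sl] Ul] := @fresh_nodes _ r.+1 U (leqnn _); unpack_uniq Ul.
  have := exchange_second H Ul sl; rewrite !negbK.
  rewrite !avoids_notin_behead; try by solve_uniq.
  rewrite (first y z) ?(first y' z); try by solve_uniq.
  by move=> E; apply: (addIr (w j z)); apply: E.
have const_j x y : x != y -> y != j -> w x y = w j i.
  move=> xy yj; have -> : w x y = w j y.
    by have [-> //|xj] := eqVneq x j; apply: first; solve_uniq.
  by have [-> //|yi] := eqVneq y i; apply: second; solve_uniq.
pose c := w j i.
have const x y : x != y -> (x, y) != (i, j) -> w x y = c.
  move=> xy; have [ey|yj _] := eqVneq y j; last exact: const_j.
  rewrite {}ey in xy *; rewrite xpair_eqE eqxx andbT => xi.
  (* For an arc into [j] from [x != i], exchange [j] for [y'] after [x]; the other three weights in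
     the identity are already known to be [c]. *)
  have U : uniq [:: x; j] by solve_uniq.
  have [[|y' [|z l]] // [sl] Ul] := @fresh_nodes _ r.+2 U (leqnn _); unpack_uniq Ul.
  have Pj : path (avoids (i, j)) j (z :: l) by apply: avoids_notin_behead; solve_uniq.
  have P1 : path (avoids (i, j)) x [:: j, z & l].
    by apply/andP; split; [rewrite /avoids xpair_eqE negb_and xi | exact: Pj].
  have P2 : path (avoids (i, j)) x [:: y', z & l].
    by apply: avoids_notin_behead; solve_uniq.
  have := exchange_second H Ul sl; rewrite !negbK => /(_ P1 P2).
  rewrite (const_j j z) ?(const_j x y') ?(const_j y' z); try by [|rewrite eq_sym].
  exact: addIr.
have gE z : g z = - (c *+ r.+2).
  (* To end in [z] without using the arc: if [z = j], leave [i] out; otherwise start in [j]. *)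
  have [x [l [U sl P elast]]] : exists x l, [/\ uniq (x :: l), size l = r.+2,
      path (avoids (i, j)) x l & last x l = z].
    have [->|zj] := eqVneq z j.
      have [[|x l] // [sl] Ul] := @fresh_nodes _ r.+2 Uij (leqnn _); unpack_uniq Ul.
      exists x, (rcons l j); rewrite size_rcons last_rcons sl; split => //.
        by rewrite mem_rcons rcons_uniq; solve_uniq.
      by apply: avoids_notin; rewrite inE mem_rcons; solve_uniq.
    have U : uniq [:: z; j] by solve_uniq.
    have [l sl Ul] := @fresh_nodes _ r.+1 U (leqnSn _); unpack_uniq Ul.
    exists j, (rcons l z); rewrite size_rcons last_rcons sl; split => //.
      by rewrite mem_rcons rcons_uniq; solve_uniq.
    by apply: avoids_notin_behead; rewrite mem_rcons; solve_uniq.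
  have := H x l; rewrite elast (path_weight_const const) // sl negbK => E.
  by apply/eqP; rewrite -addr_eq0 addrC; apply/eqP; apply: E.
move=> x l y m [Ux sl] Px [Uy sm] Py.
by rewrite !(path_weight_through const) // !gE sl sm.
Qed.

End Pivot.

(** * Dimension as rank minus one *)

Definition vec_of (R : Type) (T : finType) (x : T -> R) : 'rV[R]_#|T| :=
  \row_k x (enum_val k).

(* Since all points lie on the hyperplane [\sum_a x a = s], which misses the
   origin, affine and linear independence agree. *)
Lemma has_dim_rank (R : realFieldType) (T : finType) (X : (T -> R) -> Prop)
    (K : nat) (G : 'M[R]_(K, #|T|)) (s : R) (d : nat) :
  s != 0 -> (forall x, X x -> \sum_a x a = s) ->
  (forall x, X x -> (vec_of x <= G)%MS) ->
  (forall k, X (fun a => G k (enum_rank a))) ->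
  \rank G = d.+1 -> has_dim X d.
Proof.
move=> s0 Xs XG GX rG; split.
  (* A maximal free family of rows of [G] provides the [d.+1] points. *)
  have [f Ff] : exists f : 'I_d.+1 -> 'I_K, row_free (rowsub f G).
    by rewrite -rG; exists (maxrankfun G); apply: maxrowsub_free.
  exists (fun t a => G (f t) (enum_rank a)); split=> // mu E _ t.
  have /(row_free_inj Ff) : (\row_t mu t) *m rowsub f G = 0 *m rowsub f G.
    rewrite mul0mx; apply/rowP => k; rewrite !mxE -[RHS](E (enum_val k)).
    by apply: eq_bigr => i _; rewrite !mxE enum_valK.
  by move/rowP/(_ t); rewrite !mxE.
case=> v [Xv ind].
pose M := \matrix_(t < d.+2) vec_of (v t).
have : row_free M.
  rewrite -kermx_eq0; apply/rowV0P => u; rewrite sub_kermx => /eqP uM.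
  have E a : \sum_(t < d.+2) u 0 t * v t a = 0.
    have /rowP/(_ (enum_rank a)) := uM; rewrite !mxE => e.
    rewrite -[RHS]e; by apply: eq_bigr => t _; rewrite !mxE enum_rankK.
  apply/rowP => t; rewrite mxE; apply: (ind (u 0)) => //.
  (* Summing the vanishing combination over all coordinates gives [s] times the sum of its
     coefficients. *)
  apply: (mulIf s0); rewrite mul0r mulr_suml.
  rewrite (eq_bigr (fun i => \sum_a u 0 i * v i a)) => [|i _].
    by rewrite exchange_big big1.
  by rewrite -(Xs _ (Xv i)) mulr_sumr.
rewrite /row_free => /eqP rM.
have /mxrankS : (M <= G)%MS by apply/row_subP => t; rewrite rowK XG.
by rewrite rM rG ltnn.
Qed.

(** The single row [q] bounds the increase by one; the strict inclusion forces it. *)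
Lemma rank_add_row (R : fieldType) (m1 m2 N : nat) (A : 'M[R]_(m1, N))
    (B : 'M[R]_(m2, N)) (q : 'rV[R]_N) :
  (A <= B)%MS -> (B <= A + q)%MS -> ~~ (B <= A)%MS -> \rank B = (\rank A).+1.
Proof.
move=> AB BA nBA; apply/eqP; rewrite eqn_leq; apply/andP; split.
  apply: leq_trans (mxrankS BA) _; apply: leq_trans (mxrank_adds_leqif _ _).1 _.
  by rewrite -[leqRHS]addn1 leq_add2l rank_leq_row.
by apply: rank_ltmx; rewrite ltmxE AB.
Qed.

(** * Encoding p-paths by their internal nodes *)

Lemma all_map_val (T : choiceType) (P : pred T) (s : seq T) :
  all P s -> exists s' : seq {x | P x}, s = map val s'.
Proof.
elim: s => [|x s IHs] /=; first by exists [::].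
by case/andP=> Px /IHs[s' ->]; exists (exist _ x Px :: s').
Qed.

Section Paths.
Variables (n r : nat).
Let V := 'I_n.+1.

Definition internal := {i : V | (i != ord0) && (i != ord_max)}.

Definition full_path (x : internal) (l : seq internal) : seq V :=
  ord0 :: rcons (map val (x :: l)) ord_max.

Lemma card_internal : (0 < n)%N -> #|{: internal}| = n.-1.
Proof.
move=> n0; rewrite card_sig.
have -> : #|[pred i : V | (i != ord0) && (i != ord_max)]| = #|~: [set ord0; ord_max : V]|.
  by apply: eq_card => i; rewrite !inE negb_or.
by rewrite cardsCs setCK card_ord cards2 -val_eqE /= eq_sym -lt0n n0 subn2.
Qed.

Lemma p_path_full s : is_p_path r.+4 s ->
  exists x l, [/\ uniq (x :: l), size l = r.+2 & s = full_path x l].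
Proof.
case: s => [|i s] [] //= [ss] -> {i}.
case/lastP: s ss => // v i; rewrite size_rcons => -[sv]; rewrite last_rcons => -> {i}.
rewrite mem_rcons inE negb_or rcons_uniq => /and3P[/andP[_ n0] nn Uv] _.
have [|v' ev] := @all_map_val _ (fun i : V => (i != ord0) && (i != ord_max)) v.
  apply/allP => i iv; apply/andP; split; first by apply: contraNneq n0 => <-.
  by apply: contraNneq nn => <-.
case: v' ev => [|x l] ev; first by rewrite ev in sv.
exists x, l; rewrite /full_path -ev; split => //.
  by rewrite ev in Uv; apply: map_uniq Uv.
by move: sv; rewrite ev /= size_map => -[].
Qed.

Lemma full_p_path x l : uniq (x :: l) -> size l = r.+2 -> is_p_path r.+4 (full_path x l).
Proof.
move=> U sl; have [x0 xn] := andP (valP x).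
have n0 : (ord0 : V) != ord_max.
  apply: contraNneq x0 => e; apply/eqP/val_inj => /=.
  by move: (ltn_ord (val x)) (congr1 val e) => /=; lia.
split.
- by rewrite /= size_rcons size_map sl.
- by [].
- by rewrite /= last_rcons.
- have nv i : (i == ord0) || (i == ord_max) -> i \notin map val (x :: l).
    by apply: contraTN => /mapP[y _ ->]; rewrite negb_or (valP y).
  rewrite cons_uniq rcons_uniq mem_rcons in_cons negb_or n0 !nv ?eqxx ?orbT //.
  by rewrite (map_inj_uniq val_inj).
rewrite /= rcons_path; apply/and3P; split.
- by rewrite /is_arc eq_sym x0 n0 eqxx.
- elim: l x U {x0 xn sl} => //= y l IHl x; rewrite inE negb_or => /andP[/andP[xy _] U].
  rewrite IHl // andbT /is_arc.
  have /andP[x0 xn] := valP x; have /andP[y0 yn] := valP y.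
  by rewrite y0 xn (negPf yn) andbF (inj_eq val_inj) xy.
rewrite last_map; have /andP[y0 yn] := valP (last x l).
by rewrite /is_arc yn (negPf y0) eq_sym n0.
Qed.

End Paths.

(** * Arc weightings evaluated on incidence vectors *)

Lemma path_all_zip (V : Type) (e : rel V) x s :
  path e x s -> all (fun a => e a.1 a.2) (zip (x :: s) s).
Proof. by elim: s x => //= y s IHs x /andP[-> /IHs]. Qed.

Section Arcs.
Variables (R : realFieldType) (n : nat).
Implicit Types (a : arcD n) (s : seq 'I_n.+1).

Definition uses a s := val a \in zip s (behead s).

(** Lifting the arcs of a path to [arcD] without repetition turns sums over all arcs into sums along
    the path. *)
Lemma arcs_of_path p s : is_p_path p s ->
  exists2 z : seq (arcD n), uniq z & zip s (behead s) = map val z.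
Proof.
case: s => [|i s] [] //= _ -> _ Us Ps; have [z ez] := all_map_val (path_all_zip Ps).
exists z => //; apply: (@map_uniq _ _ val); rewrite -ez; exact: uniq_zip_behead.
Qed.

(** The value 0 off the arcs extends a weighting to all ordered pairs, as [path_weight] requires. *)
Definition arc_fun (b : arcD n -> R) (u v : 'I_n.+1) : R := oapp b 0 (insub (u, v)).

Lemma sum_incidence (b : arcD n -> R) p s : is_p_path p s ->
  \sum_a incidence R s a * b a = path_weight (arc_fun b) ord0 (behead s).
Proof.
move=> Ps; have [z Uz ez] := arcs_of_path Ps.
have -> : path_weight (arc_fun b) ord0 (behead s)
    = \sum_(e <- zip s (behead s)) arc_fun b e.1 e.2.
  by case: s Ps {ez} => [|i s] [] //= _ -> *; rewrite sum_zip_path_weight.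
rewrite ez big_map [RHS]big_uniq //= [RHS]big_mkcond; apply: eq_bigr => a _.
rewrite /incidence ez (mem_map val_inj); case: ifP => _; last by rewrite mul0r.
by rewrite mul1r /arc_fun -surjective_pairing valK.
Qed.

Lemma sum_incidence1 p s : is_p_path p s -> \sum_a incidence R s a = p%:R.
Proof.
move=> Ps; have [z Uz ez] := arcs_of_path Ps.
under eq_bigr => a _ do rewrite /incidence ez (mem_map val_inj).
rewrite -big_mkcond -big_uniq //= big_const_seq count_predT iter_addr_0.
rewrite -(size_map val) -ez size_zip size_behead.
by case: Ps => -> *; rewrite /= minnC /minn ltnSn.
Qed.

(** The potential is [w ord0]: after the shift arcs out of node 0 weigh nothing, and the
    compensation at the last internal node joins the arc into node n. This is the shape that [pivot]
    expects. *)
Lemma path_weight_full (w : 'I_n.+1 -> 'I_n.+1 -> R) (x : internal n) l :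
  path_weight w ord0 (behead (full_path x l)) =
  path_weight (fun u v : internal n =>
    w (val u) (val v) + w ord0 (val u) - w ord0 (val v)) x l
  + (w (val (last x l)) ord_max + w ord0 (val (last x l))).
Proof.
rewrite (path_weight_potential (fun u v => w (val u) (val v)) (fun u => w ord0 (val u))).
by rewrite /= path_weight_rcons path_weight_map last_map; lra.
Qed.

(** Tail 0 leads to [pivot_head], head n to [pivot_last], and two internal ends to [pivot_arc]; the
    absence of arc [(0, n)] separates the first two cases. *)
Lemma uses_pivot r a : (r.+4 <= #|{: internal n}|)%N ->
  exists thru : internal n -> seq (internal n) -> bool,
    pivot R r thru /\ forall x l, uses a (full_path x l) = thru x l.
Proof.
move=> card; case: a => -[i j] /= arc; rewrite /uses /=.
have notin k (l : seq (internal n)) : (k == ord0) || (k == ord_max) -> k \notin map val l.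
  by apply: contraTN => /mapP[y _ ->]; rewrite negb_or (valP y).
have zipE x l : ((i, j) \in zip (full_path x l) (behead (full_path x l))) =
    ~~ path (avoids (i, j)) ord0 (rcons (map val (x :: l)) ord_max).
  by rewrite mem_zip_behead.
have [/= nij j0 im n0m] := and4P arc.
have [i0|i0] := eqVneq i ord0.
  have jm : j != ord_max by move: n0m; rewrite i0 eqxx.
  have jI : (j != ord0) && (j != ord_max) by rewrite j0.
  exists (fun x _ => x == exist _ j jI); split; first exact: pivot_head.
  move=> x l; rewrite zipE /= avoids_notin.
    by rewrite andbT /avoids negbK i0 xpair_eqE eqxx.
  rewrite -rcons_cons mem_rcons inE negb_or im.
  by rewrite -[_ :: _]/(map val (x :: l)) notin // i0.
have iI : (i != ord0) && (i != ord_max) by rewrite i0.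
have [jm|jm] := eqVneq j ord_max.
  exists (fun x l => last x l == exist _ i iI); split; first exact: pivot_last.
  move=> x l; rewrite zipE rcons_path avoids_notin_behead.
    by rewrite /avoids negbK jm xpair_eqE eqxx andbT /= last_map.
  by rewrite notin // jm eqxx orbT.
have jI : (j != ord0) && (j != ord_max) by rewrite j0.
exists (fun x l => ~~ path (avoids (exist _ i iI : internal n, exist _ j jI : internal n)) x l).
split; first exact: pivot_arc.
move=> x l; rewrite zipE rcons_path /= path_map {1 3}/avoids !xpair_eqE.
rewrite !(eq_sym _ i, eq_sym _ j) (negPf i0) (negPf jm) andbF /= andbT.
by congr (~~ _); apply: eq_path.
Qed.

End Arcs.

(** * Ranks of path matrices and the facet property *)

Section Facet.
Variables (R : realFieldType) (n p : nat).
Implicit Types (a : arcD n) (s : seq 'I_n.+1) (Q : pred (seq 'I_n.+1)).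

Definition p_pathb s : bool :=
  [&& size s == p.+1, head ord0 s == ord0, last ord0 s == ord_max, uniq s
    & path (@is_arc n) ord0 (behead s)].

Lemma p_pathP s : reflect (is_p_path p s) (p_pathb s).
Proof.
by apply: (iffP and5P) => -[] => [/eqP ? /eqP ? /eqP ? ? ?|-> -> -> ? ?]; split.
Qed.

(** Tuples of fixed length form a finite type, so the paths can index the rows of a matrix. *)
Definition p_paths Q := [pred t : p.+1.-tuple 'I_n.+1 | p_pathb t && Q t].

Definition paths_mx Q : 'M[R]_(#|p_paths Q|, #|{: arcD n}|) :=
  \matrix_k vec_of (incidence R (tval (enum_val k))).

Lemma incidence_sub_paths_mx Q s : is_p_path p s -> Q s ->
  (vec_of (incidence R s) <= paths_mx Q)%MS.
Proof.
move=> Ps Qs; have /eqP ss : size s = p.+1 by case: Ps => ->.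
pose t := Tuple ss.
have tQ : t \in p_paths Q by rewrite inE /= Qs andbT; apply/p_pathP.
have -> : vec_of (incidence R s) = row (enum_rank_in tQ t) (paths_mx Q).
  by rewrite rowK enum_rankK_in.
exact: row_sub.
Qed.

Lemma polytope_sum x : @path_polytope R n p x -> \sum_a x a = p%:R.
Proof.
case=> k [lam [P [_ lam1 pP xE]]]; under eq_bigr => a _ do rewrite xE.
rewrite exchange_big /=.
under eq_bigr => t _ do rewrite -mulr_sumr (sum_incidence1 R (pP t)).
by rewrite -mulr_suml lam1 mul1r.
Qed.

Lemma incidence_polytope s : is_p_path p s -> @path_polytope R n p (incidence R s).
Proof.
move=> Ps; exists 1%N, (fun=> 1), (fun=> s); split => // [|a]; rewrite big_ord1 //.
by rewrite mul1r.
Qed.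

Lemma incidence_ge0 s a : 0 <= incidence R s a.
Proof. by rewrite /incidence; case: ifP. Qed.

(** If [x] vanishes on an arc of a path, nonnegativity of all terms forces the coefficient of that
    path to be 0, so only paths in [Q] contribute. *)
Lemma polytope_sub_paths_mx x Q : @path_polytope R n p x ->
  (forall s, is_p_path p s -> ~~ Q s -> exists2 a, uses a s & x a = 0) ->
  (vec_of x <= paths_mx Q)%MS.
Proof.
case=> k [lam [P [lam0 lam1 pP xE]]] nQ.
have -> : vec_of x = \sum_t lam t *: vec_of (incidence R (P t)).
  apply/rowP => i; rewrite mxE xE summxE; apply: eq_bigr => t _.
  by rewrite !mxE.
apply: summx_sub => t _; have [Qt|nQt] := boolP (Q (P t)).
  by apply: scalemx_sub; apply: incidence_sub_paths_mx.
have [a ua] := nQ _ (pP t) nQt; rewrite xE => /eqP; rewrite psumr_eq0 => [/allP|]; last first.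
  by move=> ? _; rewrite mulr_ge0 ?incidence_ge0.
move/(_ t (mem_index_enum _)); rewrite /incidence [_ \in _]ua mulr1 => /eqP ->.
by rewrite scale0r sub0mx.
Qed.

Lemma paths_mx_row Q k : exists s, [/\ is_p_path p s, Q s &
  row k (paths_mx Q) = vec_of (incidence R s)].
Proof.
have /andP[/p_pathP Pk Qk] := enum_valP k.
by exists (tval (enum_val k)); rewrite rowK.
Qed.

Lemma paths_mx_incidence Q k : exists s, [/\ is_p_path p s, Q s &
  forall a, paths_mx Q k (enum_rank a) = incidence R s a].
Proof.
have [s [Ps Qs /rowP E]] := paths_mx_row k; exists s; split=> // a.
by have := E (enum_rank a); rewrite !mxE enum_rankK.
Qed.

Lemma vec_of_mulmx m (x : arcD n -> R) (C : 'M_(#|{: arcD n}|, m)) i j :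
  (vec_of x *m C) i j = \sum_a x a * C (enum_rank a) j.
Proof.
rewrite mxE (reindex enum_rank) /=; last exact/onW_bij/enum_rank_bij.
by apply: eq_bigr => a _; rewrite mxE enum_rankK.
Qed.

Lemma polytope_nonneg_valid a : nonneg_valid (@path_polytope R n p) a.
Proof.
move=> x [k [lam [P [lam0 _ _ ->]]]].
by apply: sumr_ge0 => t _; rewrite mulr_ge0 ?incidence_ge0.
Qed.

Lemma polytope_ext x y : x =1 y -> @path_polytope R n p y -> @path_polytope R n p x.
Proof.
move=> xy [k [lam [P [? ? ? E]]]]; exists k, lam, P; split=> // a.
by rewrite xy E.
Qed.

End Facet.

(** Fix one path through [a], with incidence vector [q]. By the pivot property any other such path
    differs from [q] by an element of the span of the avoiding paths, so [q] alone completes that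
    span. *)
Lemma rank_paths_mx (R : realFieldType) (n r : nat) (a : arcD n) :
  (r.+4 <= #|{: internal n}|)%N ->
  let m := \rank (paths_mx R r.+4 (fun s => ~~ uses a s)) in
  (0 < m)%N /\ \rank (paths_mx R r.+4 (fun=> true) : 'M_(_, #|{: arcD n}|)) = m.+1.
Proof.
move=> card; have [thru [[avoid [x0 [l0 [[U0 s0] t0]]] key] usesE]] := uses_pivot R a card.
set GF := paths_mx R r.+4 (fun s => ~~ uses a s); set G := paths_mx _ _ _ => /=.
pose q := vec_of (incidence R (full_path x0 l0)).
have Pq := full_p_path U0 s0.
have GFa k : GF k (enum_rank a) = 0.
  have [s [_ us ->]] := paths_mx_incidence R k.
  by rewrite /incidence -[_ \in _]/(uses a s) (negPf us).
have pos : (0 < \rank GF)%N.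
  have [x [l [[U sl] tl]]] := avoid; have P := full_p_path U sl.
  have /submxP[u E] : (vec_of (incidence R (full_path x l)) <= GF)%MS.
    by apply: incidence_sub_paths_mx P _; rewrite usesE.
  (* A zero matrix would make this incidence vector zero, yet its coordinates sum to [r.+4]. *)
  rewrite lt0n mxrank_eq0; apply/eqP => GF0.
  have /eqP := sum_incidence1 R P; rewrite big1 => [|b _].
    by rewrite eq_sym pnatr_eq0.
  by have /rowP/(_ (enum_rank b)) := E; rewrite GF0 mulmx0 !mxE enum_rankK.
split=> //; apply: (@rank_add_row _ _ _ _ _ _ q).
- apply/row_subP => k.
  have [s [Ps _ ->]] := paths_mx_row R k.
  exact: incidence_sub_paths_mx.
- apply/row_subP => k; have [s [Ps _ ->]] := paths_mx_row R k.
  have [us|ns] := boolP (uses a s); last first.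
    by apply: submx_trans (addsmxSl _ _); apply: incidence_sub_paths_mx.
  rewrite -[vec_of _](subrK q) addmx_sub ?addsmxSr //.
  (* Membership is tested against the columns of the cokernel. Each column is an arc weighting that
     vanishes on all avoiding paths, so it must agree on the two paths through [a]. *)
  apply: submx_trans (addsmxSl _ _); rewrite submxE; apply/eqP/matrixP => i j.
  rewrite mulmxBl mxE [in X in _ + X]mxE !vec_of_mulmx mxE.
  set b := fun c => cokermx GF (enum_rank c) j.
  rewrite (sum_incidence b Ps) (sum_incidence b Pq).
  have [x [l [U sl es]]] := p_path_full Ps; rewrite {}es in Ps us *.
  rewrite !path_weight_full; apply/eqP; rewrite subr_eq0; apply/eqP.
  set w := fun u v => _.
  pose g (u : internal n) := arc_fun b (val u) ord_max + arc_fun b ord0 (val u).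
  rewrite -!/(g _); apply: (key w g) => //; last by rewrite -usesE.
  move=> y m [Uy sm] ty; have Py := full_p_path Uy sm.
  rewrite -[LHS](path_weight_full (arc_fun b)) -(sum_incidence b Py).
  rewrite -(vec_of_mulmx _ _ i).
  have : (vec_of (incidence R (full_path y m)) <= GF)%MS.
    by apply: incidence_sub_paths_mx => //; rewrite usesE.
  by rewrite submxE => /eqP ->; rewrite mxE.
(* Coordinate [a] is 1 in [q] but 0 in every row of [GF]. *)
apply: contraTN isT => GGF.
have /submxP[u E] : (q <= GF)%MS.
  by apply: submx_trans GGF; apply: incidence_sub_paths_mx.
have /rowP/(_ (enum_rank a)) := E; rewrite !mxE enum_rankK big1 => [|k _].
  by rewrite /incidence -[_ \in _]/(uses a _) usesE t0 => /eqP; rewrite oner_eq0.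
by rewrite GFa mulr0.
Qed.

Theorem theorem10 (R : realFieldType) (n p : nat) :
  (4 <= p)%N -> (p <= n - 1)%N ->
  forall a : arcD n,
    nonneg_valid (@path_polytope R n p) a /\
    nonneg_facet (@path_polytope R n p) a.
Proof.
move=> p4 pn a; have valid := @polytope_nonneg_valid R n p a.
split=> //; split=> //.
case: p p4 pn valid => [|[|[|[|r]]]] // _ pn valid.
have card : (r.+4 <= #|{: internal n}|)%N by rewrite card_internal; lia.
have [pos rG] := rank_paths_mx R a card.
have p0 : r.+4%:R != 0 :> R by rewrite pnatr_eq0.
(* The face has dimension [rF.-1] and the polytope [rF]; positivity of [rF] makes the predecessor
   exact. *)
set rF := \rank _ in pos rG; exists rF.-1; rewrite prednK //; split.
  apply: has_dim_rank p0 (@polytope_sum R n r.+4) _ _ rG => [x Xx|k].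
    by apply: polytope_sub_paths_mx.
  have [s [Ps _ E]] := paths_mx_incidence R k.
  exact: polytope_ext E (incidence_polytope R Ps).
have rF' : rF = rF.-1.+1 by rewrite prednK.
apply: has_dim_rank p0 _ _ _ rF' => [x [/polytope_sum //]|x [Xx xa]|k].
  by apply: polytope_sub_paths_mx => // s _; rewrite negbK => us; exists a.
have [s [Ps ns E]] := paths_mx_incidence R k.
split; first exact: polytope_ext E (incidence_polytope R Ps).
by rewrite E /incidence -[_ \in _]/(uses a s) (negPf ns).
Qed.
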